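(* Let $\mathcal D$ be a permutation-invariant probability distribution on the payoff set $\mathcal U$. Then for every CE (respectively CCE) approximator $f$, $$\mathbb E_{u\sim\mathcal D}[\mathcal E((\mathcal Qf)(u),u)]\ \le\ \mathbb E_{u\sim\mathcal D}[\mathcal E(f(u),u)],$$ where $\mathcal E$ is the equilibrium approximation for CE (respectively CCE).
   Context: Fix a number of players $n\ge2$ and finite action sets $\mathcal A_i=\{1,\dots,m_i\}$, $i\in[n]$; $\mathcal A=\prod_i\mathcal A_i$. A payoff is $u=(u_i)_{i\in[n]}$ with $u_i:\mathcal A\to[0,1]$; $\mathcal U$ is the set of all payoffs. For a joint strategy $\pi\in\Delta\mathcal A$, $u_i(\pi)=\sum_a\pi(a)u_i(a)$ and $u_i(a_i',\pi_{-i})=\sum_a\pi(a)u_i(a_i',a_{-i})$. A CE or CCE approximator is a (tacitly measurable) map $f:\mathcal U\to\Delta\mathcal A$. Equilibrium approximation: for CCE, $\mathcal E(\pi,u)=\max_{i\in[n]}\big(\max_{a_i'\in\mathcal A_i}u_i(a_i',\pi_{-i})-u_i(\pi)\big)$; for CE, $\mathcal E(\pi,u)=\max_{i\in[n]}\big(\max_{\phi_i:\mathcal A_i\to\mathcal A_i}\sum_a\pi(a)u_i(\phi_i(a_i),a_{-i})-u_i(\pi)\big)$. Permutations: $\mathcal G_i$ is the group of all bijections $\rho_i:\mathcal A_i\to\mathcal A_i$. $\rho_iu$ is the payoff with $(\rho_iu)_j(a_i,a_{-i})=u_j(\rho_i^{-1}(a_i),a_{-i})$ for all $j\in[n]$;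 $(\rho_i\pi)(a_i,a_{-i})=\pi(\rho_i^{-1}(a_i),a_{-i})$. $\mathcal D$ is permutation-invariant if for every $i$ and $\rho_i\in\mathcal G_i$, $u\sim\mathcal D$ implies $\rho_iu\sim\mathcal D$. Orbit averaging: $(\mathcal Q_if)(u)=\frac1{|\mathcal A_i|!}\sum_{\rho_i\in\mathcal G_i}\rho_i^{-1}f(\rho_iu)$ and $\mathcal Q=\mathcal Q_1\circ\cdots\circ\mathcal Q_n$. *)

(* Defs.v *)
From HB Require Import structures.
From mathcomp Require Import all_boot all_order all_fingroup all_algebra.
From mathcomp Require Import all_classical all_reals all_analysis.
Set Implicit Arguments.
Unset Strict Implicit.
Unset Printing Implicit Defensive.
Import Order.TTheory GRing.Theory Num.Theory.
Import numFieldNormedType.Exports.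
Local Open Scope classical_set_scope.
Local Open Scope ring_scope.

(* Maximum of a finite family. The initial value of the fold is a member of
   the family, so it plays no role unless I is empty (see fmaxP). *)
Definition fmax (R : realType) (I : finType) (F : I -> R) : R :=
  \big[Num.max/head 0 (codom F)]_(x : I) F x.

Lemma fmaxP (R : realType) (I : finType) (F : I -> R) : (0 < #|I|)%N ->
  (forall x, F x <= fmax F) /\ exists x, fmax F = F x.
Proof.
move=> I0; split=> [x|]; first exact: le_bigmax.
have hF : exists x, head 0 (codom F) = F x.
  have /codomP[x Fx] : head 0 (codom F) \in codom F.
    by move: I0; rewrite -(size_codom F); case: (codom F) => //= *; exact: mem_head.
  by exists x.
rewrite /fmax; apply: (big_ind (fun y => exists x, y = F x)) => // [_ _ [x ->] [y ->]|x _]; last by exists x.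
by rewrite maxEle; case: ifP => _; [exists y|exists x].
Qed.

Definition profile n (m : 'I_n -> nat) := {dffun forall i : 'I_n, 'I_(m i)}.

(* deviate a x is (x, a_{-i}), where x is an action of player i. *)
Definition deviate n (m : 'I_n -> nat) (a : profile m) (i : 'I_n)
  (x : 'I_(m i)) : profile m := [ffun j => dfwith a i x j].
Arguments deviate {n m} a {i} x.

Definition perm_profile n (m : 'I_n -> nat) (i : 'I_n) (rho : {perm 'I_(m i)})
  (a : profile m) : profile m := deviate a (rho (a i)).

Lemma perm_profileK n (m : 'I_n -> nat) (i : 'I_n) (rho : {perm 'I_(m i)}) :
  cancel (perm_profile rho) (perm_profile rho^-1%g).
Proof.
move=> a; apply/ffunP => j; rewrite /perm_profile /deviate !ffunE.
have -> : dfwith a i (rho (a i)) i = rho (a i) by rewrite dfwithin.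
rewrite permK; have [<-|ij] := eqVneq i j; first by rewrite dfwithin.
by rewrite dfwithout// ffunE dfwithout.
Qed.

Section payoff.
Variables (R : realType) (n : nat) (m : 'I_n -> nat).

Record payoff := Payoff {
  payoff_fun :> {ffun 'I_n -> {ffun profile m -> R}} ;
  _ : [forall i, forall a, 0 <= payoff_fun i a <= 1] }.

HB.instance Definition _ := [isSub for payoff_fun].
HB.instance Definition _ := [Choice of payoff by <:].

Lemma payoff_ge0_le1 (u : payoff) i a : 0 <= u i a <= 1.
Proof. by have /forallP/(_ i)/forallP/(_ a) := valP u. Qed.

Lemma payoff0_subproof : [forall i, forall a,
  0 <= [ffun _ : 'I_n => [ffun _ : profile m => 0 : R]] i a <= 1].
Proof. by apply/forallP => i; apply/forallP => a; rewrite !ffunE lexx ler01. Qed.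

HB.instance Definition _ := isPointed.Build payoff (Payoff payoff0_subproof).

(* The Borel sigma-algebra of the cube is generated by its coordinates. *)
Definition payoff_cylinders : set (set payoff) :=
  \bigcup_(p in [set: 'I_n * profile m])
    preimage_set_system setT (fun u : payoff => u p.1 p.2) measurable.

HB.instance Definition _ := @isMeasurable.Build (sigma_display payoff_cylinders)
  payoff <<s payoff_cylinders >> (@sigma_algebra0 _ setT payoff_cylinders)
  (@sigma_algebraC _ payoff_cylinders)
  (@sigma_algebra_bigcup _ setT payoff_cylinders).

Lemma perm_payoff_subproof (i : 'I_n) (rho : {perm 'I_(m i)}) (u : payoff) :
  [forall j, forall a, 0 <=
    [ffun j => [ffun a => u j (perm_profile rho^-1%g a)]] j a <= 1].
Proof.
by apply/forallP => j; apply/forallP => a; rewrite !ffunE payoff_ge0_le1.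
Qed.

Definition perm_payoff (i : 'I_n) (rho : {perm 'I_(m i)}) (u : payoff) : payoff :=
  Payoff (perm_payoff_subproof rho u).

Definition perm_invariant (D : probability payoff R) : Prop :=
  forall (i : 'I_n) (rho : {perm 'I_(m i)}) (B : set payoff),
    measurable B -> pushforward D (perm_payoff rho) B = D B.

Record strategy := Strategy {
  strategy_fun :> {ffun profile m -> R} ;
  _ : [forall a, 0 <= strategy_fun a] && (\sum_a strategy_fun a == 1) }.

HB.instance Definition _ := [isSub for strategy_fun].
HB.instance Definition _ := [Choice of strategy by <:].

Lemma strategy_ge0 (pi : strategy) a : 0 <= pi a.
Proof. by have /andP[/forallP/(_ a)] := valP pi. Qed.

Lemma strategy_sum1 (pi : strategy) : \sum_a pi a = 1.
Proof. by have /andP[_ /eqP] := valP pi. Qed.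

Lemma perm_strategy_subproof (i : 'I_n) (rho : {perm 'I_(m i)}) (pi : strategy) :
  let p := [ffun a => pi (perm_profile rho^-1%g a)] in
  [forall a, 0 <= p a] && (\sum_a p a == 1).
Proof.
apply/andP; split; first by apply/forallP => a; rewrite ffunE strategy_ge0.
rewrite (reindex_inj (can_inj (perm_profileK rho))) -(strategy_sum1 pi).
by apply/eqP/eq_bigr => a _; rewrite ffunE perm_profileK.
Qed.

Definition perm_strategy (i : 'I_n) (rho : {perm 'I_(m i)}) (pi : strategy) :
  strategy := Strategy (perm_strategy_subproof rho pi).

Lemma orbit_average_subproof (i : 'I_n) (f : payoff -> strategy) (u : payoff) :
  let p := [ffun a => ((m i)`!)%:R^-1 * \sum_(rho : {perm 'I_(m i)})
              perm_strategy rho^-1%g (f (perm_payoff rho u)) a] in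
  [forall a, 0 <= p a] && (\sum_a p a == 1).
Proof.
apply/andP; split.
  apply/forallP => a; rewrite ffunE mulr_ge0 ?invr_ge0 ?ler0n//.
  by apply: sumr_ge0 => rho _; exact: strategy_ge0.
under eq_bigr do rewrite ffunE.
rewrite -mulr_sumr exchange_big.
under eq_bigr => rho _ do
  rewrite (strategy_sum1 (perm_strategy rho^-1%g (f (perm_payoff rho u)))).
by rewrite sumr_const card_Sn mulVf.
Qed.

Definition orbit_average1 (i : 'I_n) (f : payoff -> strategy) :
    payoff -> strategy :=
  fun u => Strategy (orbit_average_subproof i f u).

(* enum 'I_n is increasing, so that this is Q_1 (Q_2 (.. (Q_n f))). *)
Definition orbit_average (f : payoff -> strategy) : payoff -> strategy :=
  foldr orbit_average1 f (enum 'I_n).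

(* Borel measurability into the simplex, a subspace of R^(profile m), is
   measurability of the coordinates. *)
Definition measurable_approximator (f : payoff -> strategy) : Prop :=
  forall a, measurable_fun [set: payoff] (fun u => f u a).

Definition expected_payoff (pi : strategy) (u : payoff) (i : 'I_n) : R :=
  \sum_a pi a * u i a.

Definition deviation_payoff (pi : strategy) (u : payoff) (i : 'I_n)
    (x : 'I_(m i)) : R :=
  \sum_a pi a * u i (deviate a x).

Definition swap_payoff (pi : strategy) (u : payoff) (i : 'I_n)
    (phi : {ffun 'I_(m i) -> 'I_(m i)}) : R :=
  \sum_a pi a * u i (deviate a (phi (a i))).

Definition cce_approx (pi : strategy) (u : payoff) : R :=
  fmax (fun i => fmax (@deviation_payoff pi u i) - expected_payoff pi u i).

Definition ce_approx (pi : strategy) (u : payoff) : R :=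
  fmax (fun i => fmax (@swap_payoff pi u i) - expected_payoff pi u i).

End payoff.

(* Main.v *)
(* A deviation of player i is a family of maps T k of the profiles, and the
   error is a maximum over players and deviations of functions affine in the
   strategy. Relabelling the actions of a player only permutes each family of
   deviations, so by convexity the error of (Q_j f)(u) at u is at most the
   average over rho of the error of f(rho u) at rho u, and the invariance of
   the distribution makes each of these terms have the same expectation. *)
Require Import Defs.
From HB Require Import structures.
From mathcomp Require Import all_boot all_order all_fingroup all_algebra.
From mathcomp Require Import all_classical all_reals all_analysis.
From mathcomp Require Import measurable_realfun.
Set Implicit Arguments.
Unset Strict Implicit.
Unset Printing Implicit Defensive.
Import Order.TTheory GRing.Theory Num.Theory.
Import numFieldNormedType.Exports.
Local Open Scope classical_set_scope.
Local Open Scope ring_scope.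

(** * Bounds and measurability for maxima of finite families *)

Section fmax.
Variables (R : realType) (I : finType).
Hypothesis I0 : (0 < #|I|)%N.

Lemma fmax_le (F : I -> R) (c : R) : (forall x, F x <= c) -> fmax F <= c.
Proof. by move=> Fc; have [_ [x ->]] := fmaxP F I0. Qed.

(** The initial value in [fmax] is read off [codom F]. Starting instead from a fixed index [x0]
    makes it visibly measurable when [F] varies with a parameter. *)
Lemma fmax_bigmax (F : I -> R) (x0 : I) :
  fmax F = \big[Num.max/F x0]_(x : I) F x.
Proof.
apply/eqP; rewrite eq_le; apply/andP; split.
  by apply: fmax_le => x; exact: le_bigmax.
by apply/bigmax_leP; split=> [|x _]; have [le_F _] := fmaxP F I0; exact: le_F.
Qed.

Lemma normr_fmax_le (F : I -> R) (c : R) :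
  (forall x, `|F x| <= c) -> `|fmax F| <= c.
Proof. by move=> Fc; have [_ [x ->]] := fmaxP F I0. Qed.

Lemma measurable_fmax d (T : measurableType d) (F : T -> I -> R) :
  (forall x, measurable_fun [set: T] (F ^~ x)) ->
  measurable_fun [set: T] (fun t => fmax (F t)).
Proof.
move=> mF; have [x0 _] : exists x0 : I, x0 \in I by exact/card_gt0P.
under eq_fun do rewrite (fmax_bigmax _ x0).
(* The start value [F t x0] stays the same as the index list shrinks, so the base case is
   measurability at [x0]. *)
elim: (index_enum I) => [|x s IHs].
  by under eq_fun do rewrite big_nil; exact: mF.
by under eq_fun do rewrite big_cons; exact: measurable_maxr.
Qed.

End fmax.

(** * Unilateral deviations and relabellings of profiles *)

Section deviate.
Variables (n : nat) (m : 'I_n -> nat).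
Implicit Types (a : profile m) (i j : 'I_n).

Lemma deviate_same a i (x : 'I_(m i)) : deviate a x i = x.
Proof. by rewrite ffunE dfwithin. Qed.

Lemma deviate_other a i (x : 'I_(m i)) j : i != j -> deviate a x j = a j.
Proof. by move=> ij; rewrite ffunE dfwithout. Qed.

Lemma deviate_deviate a i (x y : 'I_(m i)) :
  deviate (deviate a x) y = deviate a y.
Proof.
apply/ffunP => j; have [<-|ij] := eqVneq i j; first by rewrite !deviate_same.
by rewrite !deviate_other.
Qed.

Lemma deviateC a i j (x : 'I_(m i)) (y : 'I_(m j)) : i != j ->
  deviate (deviate a x) y = deviate (deviate a y) x.
Proof.
move=> ij; apply/ffunP => k; have [<-|ik] := eqVneq i k.
  by rewrite deviate_same deviate_other 1?eq_sym// deviate_same.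
rewrite (deviate_other _ _ ik); have [<-|jk] := eqVneq j k.
  by rewrite !deviate_same.
by rewrite !deviate_other.
Qed.

Lemma deviate_perm i j (rho : {perm 'I_(m j)}) (x : 'I_(m i)) a : i != j ->
  deviate (perm_profile rho a) x = perm_profile rho (deviate a x).
Proof.
move=> ij; rewrite /perm_profile deviateC 1?eq_sym//.
by rewrite (deviate_other _ _ ij).
Qed.

Lemma deviate_perm_same i (rho : {perm 'I_(m i)}) (x : 'I_(m i)) a :
  deviate (perm_profile rho a) x = perm_profile rho (deviate a (rho^-1%g x)).
Proof.
by rewrite /perm_profile !deviate_deviate deviate_same permKV.
Qed.

(** For distinct players the two maps act on different coordinates and commute; for the same player,
    [phi] is conjugated by [rho]. *)
Lemma deviate_swap_equivariant i (phi : {ffun 'I_(m i) -> 'I_(m i)}) j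
    (rho : {perm 'I_(m j)}) :
  exists phi' : {ffun 'I_(m i) -> 'I_(m i)}, forall a,
    let b := perm_profile rho a in
    deviate b (phi (b i)) = perm_profile rho (deviate a (phi' (a i))).
Proof.
have [ij|ij] := eqVneq i j; last first.
  exists phi => a /=; rewrite deviate_perm//.
  by rewrite deviate_other 1?eq_sym.
subst j; exists [ffun x => rho^-1%g (phi (rho x))] => a /=.
by rewrite deviate_perm_same deviate_same ffunE.
Qed.

Lemma deviate_equivariant i (x : 'I_(m i)) j (rho : {perm 'I_(m j)}) :
  exists x' : 'I_(m i), forall a,
    deviate (perm_profile rho a) x = perm_profile rho (deviate a x').
Proof.
have [ij|ij] := eqVneq i j; last by exists x => a; rewrite deviate_perm.
by subst j; exists (rho^-1%g x) => a; rewrite deviate_perm_same.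
Qed.

End deviate.

(** * Measurability of relabelling and of orbit averaging *)

Section measurability.
Variables (R : realType) (n : nat) (m : 'I_n -> nat).

Lemma measurable_payoff_coord (i : 'I_n) (a : profile m) :
  measurable_fun [set: payoff R m] (fun u => u i a).
Proof.
move=> _ B mB; apply: sub_sigma_algebra.
by exists (i, a) => //; exists B.
Qed.

Lemma measurable_perm_payoff (j : 'I_n) (rho : {perm 'I_(m j)}) :
  measurable_fun [set: payoff R m] (perm_payoff rho).
Proof.
(* It suffices to pull back the generating cylinders, and relabelling by [rho] turns the coordinate
   at [a] into the one at [perm_profile rho^-1 a]. *)
apply: (measurability (@payoff_cylinders R n m)) => // _ [_ [[i a] _ [B mB <-]] <-].
rewrite !setTI -comp_preimage -[X in measurable X]setTI.
have -> : (fun u : payoff R m => u i a) \o perm_payoff rho =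
    fun u => u i (perm_profile rho^-1%g a).
  by apply/funext => u /=; rewrite !ffunE.
exact: measurable_payoff_coord.
Qed.

Lemma orbit_average1E (j : 'I_n) (f : payoff R m -> strategy R m) u a :
  orbit_average1 j f u a = ((m j)`!)%:R^-1 *
    \sum_(rho : {perm 'I_(m j)}) f (perm_payoff rho u) (perm_profile rho a).
Proof. by rewrite ffunE; under eq_bigr do rewrite ffunE invgK. Qed.

Lemma measurable_orbit_average1 (j : 'I_n) (f : payoff R m -> strategy R m) :
  measurable_approximator f -> measurable_approximator (orbit_average1 j f).
Proof.
move=> mf a; under eq_fun do rewrite orbit_average1E.
apply: measurable_funM => //; apply: measurable_sum => rho.
apply: (measurableT_comp (mf (perm_profile rho a))).
exact: measurable_perm_payoff.
Qed.

End measurability.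

(** * Regret for a general family of deviations *)

Section regret.
Variables (R : realType) (n : nat) (m : 'I_n -> nat).
Variables (K : 'I_n -> finType) (T : forall i, K i -> profile m -> profile m).
Hypotheses (n_gt0 : (0 < n)%N) (K_gt0 : forall i, (0 < #|K i|)%N).
Implicit Types (f : payoff R m -> strategy R m) (u : payoff R m).

(** Common form of both errors: self-maps of ['I_(m i)] as [K i] give [ce_approx], single actions
    give [cce_approx]. *)
Definition regret (pi : strategy R m) u : R :=
  fmax (fun i => fmax (fun k : K i => \sum_a pi a * u i (T k a))
                 - expected_payoff pi u i).

Let card_players : (0 < #|'I_n|)%N. Proof. by rewrite card_ord. Qed.

Lemma strategy_mean_ge0_le1 (pi : strategy R m) (v : profile m -> R) :
  (forall a, 0 <= v a <= 1) -> 0 <= \sum_a pi a * v a <= 1.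
Proof.
move=> v01; apply/andP; split.
  by apply: sumr_ge0 => a _; case/andP: (v01 a) => v0 _;
     rewrite mulr_ge0// strategy_ge0.
rewrite -(strategy_sum1 pi); apply: ler_sum => a _.
by rewrite ler_piMr ?strategy_ge0//; case/andP: (v01 a).
Qed.

(** Each entry is a difference of two means of values in [0, 1]. The bound serves to make the regret
    integrable. *)
Lemma regret_norm_le1 pi u : `|regret pi u| <= 1.
Proof.
apply: normr_fmax_le => // i.
have [_ [k ->]] := fmaxP (fun k : K i => \sum_a pi a * u i (T k a)) (K_gt0 i).
have /andP[d0 d1] := strategy_mean_ge0_le1 pi (fun a => payoff_ge0_le1 u i (T k a)).
have /andP[e0 e1] := strategy_mean_ge0_le1 pi (payoff_ge0_le1 u i).
rewrite ler_norml; apply/andP; split.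
  by rewrite -[- 1]add0r lerB.
by rewrite -[leRHS]subr0 lerB.
Qed.

Lemma measurable_regret f : measurable_approximator f ->
  measurable_fun [set: payoff R m] (fun u => regret (f u) u).
Proof.
move=> mf; apply: measurable_fmax => // i; apply: measurable_funB.
  apply: measurable_fmax => // k; apply: measurable_sum => a.
  by apply: measurable_funM; [exact: mf|exact: measurable_payoff_coord].
apply: measurable_sum => a.
by apply: measurable_funM; [exact: mf|exact: measurable_payoff_coord].
Qed.

Hypothesis T_equivariant : forall i (k : K i) j (rho : {perm 'I_(m j)}),
  exists k' : K i, forall a,
    T k (perm_profile rho a) = perm_profile rho (T k' a).

(** Substituting [perm_profile rho a] for [a] moves the relabelling from the strategy to [v], where
    the relabelled payoff can absorb it. *)
Lemma orbit_average1_mean j f u (v : profile m -> R) :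
  \sum_a orbit_average1 j f u a * v a = ((m j)`!)%:R^-1 *
    \sum_(rho : {perm 'I_(m j)})
      \sum_a f (perm_payoff rho u) a * v (perm_profile rho^-1%g a).
Proof.
under eq_bigr do rewrite orbit_average1E -mulrA mulr_suml.
rewrite -mulr_sumr exchange_big; congr (_ * _); apply: eq_bigr => rho _.
rewrite [RHS](reindex_inj (can_inj (perm_profileK rho))).
by apply: eq_bigr => a _; rewrite perm_profileK.
Qed.

Lemma regret_orbit_average1_le j f u :
  regret (orbit_average1 j f u) u <= ((m j)`!)%:R^-1 *
    \sum_(rho : {perm 'I_(m j)})
      regret (f (perm_payoff rho u)) (perm_payoff rho u).
Proof.
apply: fmax_le => // i.
(* Once [k] attains the maximum, the difference is linear in the strategy, so the bound can be
   checked separately for each [rho]. *)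
have [_ [k ->]] := fmaxP
  (fun k : K i => \sum_a orbit_average1 j f u a * u i (T k a)) (K_gt0 i).
rewrite /expected_payoff !orbit_average1_mean -mulrBr -sumrB.
rewrite ler_wpM2l ?invr_ge0 ?ler0n//; apply: ler_sum => rho _.
(* The inverse appears because [u'] at [b] is [u] at [perm_profile rho^-1 b]; thus the gain from [k]
   at [u] is the gain from [k'] at [u']. *)
have [k' Tk] := T_equivariant k rho^-1%g.
set u' := perm_payoff rho u; set pi := f u'.
have [le_regret _] := fmaxP
  (fun i => fmax (fun k : K i => \sum_a pi a * u' i (T k a))
            - expected_payoff pi u' i) card_players.
apply: le_trans (le_regret i); apply: lerB.
  have [le_dev _] := fmaxP (fun k : K i => \sum_a pi a * u' i (T k a)) (K_gt0 i).
  apply: le_trans (le_dev k'); apply: ler_sum => a _.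
  by rewrite /u' !ffunE Tk.
by apply: ler_sum => a _; rewrite /u' !ffunE.
Qed.

(** * Integration against an invariant distribution *)

Variables (D : probability (payoff R m) R).
Hypothesis D_inv : perm_invariant D.

Lemma integrable_norm_le1 (g : payoff R m -> R) :
  measurable_fun setT g -> (forall u, `|g u| <= 1) ->
  D.-integrable setT (EFin \o g).
Proof.
move=> mg g1; apply: measurable_bounded_integrable => //.
  by rewrite [ltLHS](probability_setT D) ltry.
by exists 1; split => // M M1 u _; exact: le_trans (g1 u) (ltW M1).
Qed.

Lemma integrable_regret f : measurable_approximator f ->
  D.-integrable setT (EFin \o (fun u => regret (f u) u)).
Proof.
move=> mf; apply: integrable_norm_le1; first exact: measurable_regret.
by move=> u; exact: regret_norm_le1.
Qed.

(** The left side is the integral of [g] against the pushforward of [D], which agrees with [D] on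
    measurable sets. *)
Lemma integral_perm_payoff j (rho : {perm 'I_(m j)}) (g : payoff R m -> \bar R) :
  D.-integrable setT g -> D.-integrable setT (g \o perm_payoff rho) ->
  (\int[D]_u g (perm_payoff rho u) = \int[D]_u g u)%E.
Proof.
move=> ig igrho; have mrho := measurable_perm_payoff (R := R) rho.
have := integral_pushforward mrho (measurable_int D ig) igrho measurableT.
rewrite preimage_setT => <-; apply: eq_measure_integral => B mB _; exact: D_inv.
Qed.

Lemma expected_regret_orbit_average1_le j f : measurable_approximator f ->
  ('E_D[fun u => regret (orbit_average1 j f u) u]
     <= 'E_D[fun u => regret (f u) u])%E.
Proof.
move=> mf; rewrite unlock.
pose g (u : payoff R m) := (regret (f u) u)%:E.
have ig : D.-integrable setT g by exact: integrable_regret.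
have igrho (rho : {perm 'I_(m j)}) : D.-integrable setT (g \o perm_payoff rho).
  apply: (@integrable_norm_le1 (fun u => regret (f (perm_payoff rho u)) _)).
    exact: (measurableT_comp (measurable_regret mf) (measurable_perm_payoff rho)).
  by move=> u; exact: regret_norm_le1.
have isum : D.-integrable setT
    (fun u => \sum_(rho : {perm 'I_(m j)}) g (perm_payoff rho u))%E.
  by apply: integrable_sum => // rho _; exact: igrho.
apply: (@le_trans _ _
    (\int[D]_u (((m j)`!)%:R^-1%:E *
       \sum_(rho : {perm 'I_(m j)}) g (perm_payoff rho u)))%E).
  apply: le_integral => //.
  - exact: (integrable_regret (measurable_orbit_average1 j mf)).
  - exact: integrableZl.
  - by move=> u _; rewrite sumEFin -EFinM lee_fin regret_orbit_average1_le.
rewrite integralZl// integral_sum//.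
under eq_bigr do rewrite integral_perm_payoff//.
(* Finiteness of the expectation allows real arithmetic, in which the [(m j)!] equal terms cancel
   the normalising factor. *)
rewrite -(fineK (integrable_fin_num measurableT ig)) sumEFin -EFinM lee_fin.
by rewrite sumr_const card_Sn -[X in _ * X]mulr_natl mulrA mulVf ?mul1r// pnatr_eq0 -lt0n
  fact_gt0.
Qed.

Lemma expected_regret_orbit_average_le f : measurable_approximator f ->
  ('E_D[fun u => regret (orbit_average f u) u]
     <= 'E_D[fun u => regret (f u) u])%E.
Proof.
rewrite /orbit_average => mf; set s := enum 'I_n.
(* Measurability is carried through the induction, since the one-player step requires it of the
   partially averaged approximator. *)
suff [] : measurable_approximator (foldr (@orbit_average1 R n m) f s) /\
    ('E_D[fun u => regret (foldr (@orbit_average1 R n m) f s u) u]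
       <= 'E_D[fun u => regret (f u) u])%E by [].
elim: s => [//|j s [ms IHs]] /=; split.
  exact: measurable_orbit_average1.
exact: le_trans (expected_regret_orbit_average1_le j ms) IHs.
Qed.

End regret.

Theorem theorem4p6 (R : realType) (n : nat) (n_ge2 : (2 <= n)%N)
    (m : 'I_n -> nat) (m_gt0 : forall i, (0 < m i)%N)
    (D : probability (payoff R m) R) (D_inv : perm_invariant D)
    (f : payoff R m -> strategy R m) (mf : measurable_approximator f) :
  ('E_D[fun u => ce_approx (orbit_average f u) u]
     <= 'E_D[fun u => ce_approx (f u) u])%E /\
  ('E_D[fun u => cce_approx (orbit_average f u) u]
     <= 'E_D[fun u => cce_approx (f u) u])%E.
Proof.
have n_gt0 : (0 < n)%N by exact: leq_trans n_ge2.
split.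
  apply: (@expected_regret_orbit_average_le R n m
    (fun i => {ffun 'I_(m i) -> 'I_(m i)})
    (fun i phi a => deviate a (phi (a i)))) => // [i|i phi j rho].
    by rewrite card_ffun card_ord expn_gt0 m_gt0.
  exact: deviate_swap_equivariant.
apply: (@expected_regret_orbit_average_le R n m
  (fun i => 'I_(m i)) (fun i x a => deviate a x)) => // [i|i x j rho].
  by rewrite card_ord.
exact: deviate_equivariant.
Qed.
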